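(* Let $\alpha\in(0,1)$, $1<p<\frac n\alpha$. Let $X=X(Q_0)$ and $Y=Y(Q_0)$ be rearrangement invariant spaces such that the local Riesz potential $I_{\alpha,Q_0}$ is bounded from $Y$ to $X$. Then $W^\alpha_{p,Y}\subset GaRo_X$; more precisely, there is a constant $C_n$ (depending on $n,p,\alpha$) such that for every $f\in W^{\alpha}_{p,Y}$ the function $C_nI_{\alpha,Q_0}(D_{p,\alpha}(f))$ belongs to $\Gamma_f^X$ and \[ \|f\|_{GaRo_X}\le C_n\|I_{\alpha,Q_0}\|_{Y\to X}\|f\|_{W^\alpha_{p,Y}}. \]
   Context: $Q_0=(0,1)^n$; cubes are subcubes of $Q_0$ with sides parallel to the axes. $P$ is the set of countable families $\{Q_i\}_{i\in I}$ of subcubes of $Q_0$ with pairwise disjoint interiors. A rearrangement invariant (r.i.) space is a Banach function space $X$ on $Q_0$ such that $g\in X$, $f^*=g^*$ imply $f\in X$, $\|f\|_X=\|g\|_X$ ($f^*$ = decreasing rearrangement). For measurable $f$ on $Q_0$, \[ D_{p,\alpha}(f)(y)=\Big\{\int_{Q_0}\frac{|f(x)-f(y)|^p}{|x-y|^{n+\alpha p}}\,dx\Big\}^{1/p},\ y\in Q_0, \] $W^\alpha_{p,Y}=\{f:\|f\|_{W^\alpha_{p,Y}}:=\|D_{p,\alpha}(f)\|_Y<\infty\}$, and $I_{\alpha,Q_0}(g)(z)=\int_{Q_0}\frac{g(y)}{|z-y|^{n-\alpha}}\,dy$, $z\in Q_0$. An integrable $f$ belongs to $GaRo_X$ if there is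 $\gamma\in X$ such that for all $\{Q_i\}_{i\in I}\in P$, $\sum_i\frac1{|Q_i|}\int_{Q_i}\int_{Q_i}|f(x)-f(y)|\,dx\,dy\le\sum_i\int_{Q_i}\gamma$; $\Gamma_f^X$ is the set of such $\gamma$, and $\|f\|_{GaRo_X}=\inf\{\|\gamma\|_X:\gamma\in\Gamma_f^X\}$. *)

(* Defs.v *)
From HB Require Import structures.
From mathcomp Require Import all_boot all_order all_algebra.
From mathcomp Require Import all_classical all_reals all_analysis.
Set Implicit Arguments. Unset Strict Implicit. Unset Printing Implicit Defensive.
Import Order.TTheory GRing.Theory Num.Theory.
Local Open Scope classical_set_scope.
Local Open Scope ring_scope.

Section Defs.
Variables (R : realType) (n : nat).
Notation V := 'rV[R]_n.

Definition coord (x : V) (i : 'I_n) : R := x ord0 i.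

Definition edist (x y : V) : R :=
  Num.sqrt (\sum_(i < n) (coord x i - coord y i) ^+ 2).

Definition obox (a b : V) : set V :=
  [set x | forall i, coord a i < coord x i < coord b i].
Definition bvol (a b : V) : R := \prod_(i < n) Num.max 0 (coord b i - coord a i).

Definition lam (A : set V) : \bar R :=
  ereal_inf [set (\sum_(k <oo) (bvol (ab.1 k) (ab.2 k))%:E)%E
            | ab in [set ab : (nat -> V) * (nat -> V) |
                       A `<=` \bigcup_k obox (ab.1 k) (ab.2 k)]].

Definition lmeas (A : set V) : Prop :=
  forall E : set V, lam E = (lam (E `&` A) + lam (E `&` ~` A))%E.

Definition Q0 : set V := [set x | forall i, 0 < coord x i < 1].

Definition ae (P : V -> Prop) : Prop :=
  exists N : set V, lam N = 0%E /\ forall x, Q0 x -> ~ N x -> P x.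

Definition emeas (f : V -> \bar R) : Prop :=
  forall t : R, lmeas (Q0 `&` [set x | (t%:E < f x)%E]).

Definition Mplus (f : V -> \bar R) : Prop :=
  emeas f /\ forall x, Q0 x -> (0 <= f x)%E.

(* Lebesgue integral over A of a nonnegative function (layer cake) *)
Definition lint (A : set V) (F : V -> \bar R) : \bar R :=
  (\int[lebesgue_measure]_(t in `]0%R, +oo[%classic) lam (A `&` [set x | (t%:E < F x)%E]))%E.

Definition distr (f : V -> \bar R) (s : R) : \bar R :=
  lam (Q0 `&` [set x | (s%:E < `|f x|)%E]).
Definition drearr (f : V -> \bar R) (t : R) : \bar R :=
  ereal_inf [set s%:E | s in [set s : R | 0 <= s /\ (distr f s <= t%:E)%E]].

(* Banach function norm on Q0 (Bennett--Sharpley, Def. I.1.1) which is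
   rearrangement invariant (Def. II.4.1 phrased with equal decreasing rearrangements). *)
Record rinorm := RINorm {
  rho : (V -> \bar R) -> \bar R;
  rho_ge0 : forall f, Mplus f -> (0 <= rho f)%E;
  rho_eq0 : forall f, Mplus f -> (rho f = 0%E <-> ae (fun x => f x = 0%E));
  rho_scale : forall f (a : R), Mplus f -> 0 <= a ->
     rho (fun x => (a%:E * f x)%E) = (a%:E * rho f)%E;
  rho_triangle : forall f g, Mplus f -> Mplus g ->
     (rho (fun x => f x + g x) <= rho f + rho g)%E;
  rho_mono : forall f g, Mplus f -> Mplus g -> ae (fun x => (g x <= f x)%E) ->
     (rho g <= rho f)%E;
  rho_fatou : forall (fs : nat -> V -> \bar R) f, (forall k, Mplus (fs k)) -> Mplus f ->
     ae (fun x => (forall k, (fs k x <= fs k.+1 x)%E) /\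
                  ereal_sup (range (fun k => fs k x)) = f x) ->
     rho f = ereal_sup (range (fun k => rho (fs k)));
  rho_indic : forall E, lmeas E -> E `<=` Q0 ->
     (rho (fun x => (\1_E x)%:E) < +oo)%E;
  rho_local : forall E, lmeas E -> E `<=` Q0 ->
     exists C : R, 0 < C /\ forall f, Mplus f -> (lint E f <= C%:E * rho f)%E;
  rho_ri : forall f g, Mplus f -> Mplus g ->
     (forall t : R, 0 <= t -> drearr f t = drearr g t) -> rho f = rho g
}.

Definition Dpa (alpha p : R) (f : V -> R) (y : V) : \bar R :=
  poweR (lint Q0 (fun x => (powR `|f x - f y| p
                    / powR (edist x y) (n%:R + alpha * p))%:E)) p^-1.

Definition W_norm (Y : rinorm) (alpha p : R) (f : V -> R) : \bar R :=
  rho Y (Dpa alpha p f).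

Definition in_W (Y : rinorm) (alpha p : R) (f : V -> R) : Prop :=
  emeas (fun x => (f x)%:E) /\ (W_norm Y alpha p f < +oo)%E.

(* local Riesz potential I_{alpha,Q0} (on nonnegative functions) *)
Definition riesz (alpha : R) (g : V -> \bar R) (z : V) : \bar R :=
  lint Q0 (fun y => (g y * (powR (edist z y) (alpha - n%:R))%:E)%E).

Definition opnorm (alpha : R) (X Y : rinorm) : \bar R :=
  ereal_sup [set rho X (riesz alpha g) | g in [set g | Mplus g /\ (rho Y g <= 1)%E]].

Definition ocube (a : V) (l : R) : set V :=
  [set x | forall i, coord a i < coord x i < coord a i + l].

(* countable families (indexed by I ⊆ nat) of subcubes of Q0
   with pairwise disjoint interiors *)
Definition cube_family (I : set nat) (a : nat -> V) (l : nat -> R) : Prop :=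
  (forall i, I i -> 0 < l i /\ ocube (a i) (l i) `<=` Q0) /\
  (forall i j, I i -> I j -> i <> j -> ocube (a i) (l i) `&` ocube (a j) (l j) = set0).

Definition integrable (f : V -> R) : Prop :=
  emeas (fun x => (f x)%:E) /\ (lint Q0 (fun x => `|f x|%:E) < +oo)%E.

Definition Gamma (X : rinorm) (f : V -> R) (g : V -> \bar R) : Prop :=
  Mplus g /\ (rho X g < +oo)%E /\
  forall (I : set nat) (a : nat -> V) (l : nat -> R), cube_family I a l ->
    (\sum_(i <oo | i \in I)
        (((l i ^+ n)^-1)%:E *
          lint (ocube (a i) (l i)) (fun y =>
            lint (ocube (a i) (l i)) (fun x => `|f x - f y|%:E))) <=
     \sum_(i <oo | i \in I) lint (ocube (a i) (l i)) g)%E.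

Definition GaRo (X : rinorm) (f : V -> R) : Prop :=
  integrable f /\ exists g, Gamma X f g.

Definition garo_norm (X : rinorm) (f : V -> R) : \bar R :=
  ereal_inf [set rho X g | g in Gamma X f].

End Defs.

(* Main.v *)
Require Import Defs.
From HB Require Import structures.
From mathcomp Require Import all_boot all_order all_algebra.
From mathcomp Require Import ring lra.
From mathcomp Require Import all_classical all_reals all_analysis.
From mathcomp Require Import measurable_realfun.
Set Implicit Arguments. Unset Strict Implicit. Unset Printing Implicit Defensive.
Import Order.TTheory GRing.Theory Num.Theory.
Import numFieldNormedType.Exports.
Local Open Scope classical_set_scope.
Local Open Scope ring_scope.

(* Fix a subcube Q of side l. For x, y in Q the distance |x - y| is at most
   sqrt(n) l, so Hölder in x gives
     int_Q |f(x) - f(y)| dx <= K l^(n + alpha) D f(y)   for y in Q,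
   while, for z in Q, I_alpha(D f)(z) >= (sqrt(n) l)^(alpha - n) int_Q D f.
   Integrating the first bound over y and the second over z, both sides of the
   GaRo condition on Q compare with l^alpha int_Q D f. The norm bound is then
   the definition of the operator norm.

   Integrals are layer-cake integrals against the outer measure [lam]. Monotone
   convergence holds for them without measurability, because [lam] is
   continuous along arbitrary increasing sequences of sets; hence the integral
   of a family of lower semicontinuous functions is lower semicontinuous in
   the parameter. This makes I_alpha(g) measurable, and D f as well: it is a
   lower semicontinuous function of (y, f(y)). *)

(** * Lebesgue outer measure: subadditivity, scaling, measurability of half-spaces *)

Section outer_measure_lam.
Context {R : realType} {n : nat}.
Local Notation V := 'rV[R]_n.+1.
Local Notation coord := Defs.coord.
Implicit Types (A B E : set V) (a b x y z : V).

Lemma bvol_ge0 a b : 0 <= bvol a b.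
Proof. by apply: prodr_ge0 => i _; rewrite le_max lexx. Qed.

Lemma lam_ge0 A : (0 <= lam A)%E.
Proof.
apply: le_ereal_inf_tmp => _ [ab _ <-].
by apply: nneseries_ge0 => k _ _; rewrite lee_fin bvol_ge0.
Qed.

Lemma le_lam A B : A `<=` B -> (lam A <= lam B)%E.
Proof.
move=> AB; apply: ereal_inf_le_tmp => _ [ab /= Bab <-].
by exists ab => //=; exact: subset_trans Bab.
Qed.

(** When all [lam (A m)] are finite, [A m] is covered with excess at most [e / 2 ^ m.+1], and a
    bijection of [nat] with [nat * nat] enumerates all the boxes as one cover. *)
Lemma lam_sigma_subadditive : sigma_subadditive (@lam R n.+1).
Proof.
move=> A; have [[i ioo]|] := pselect (exists i, lam (A i) = +oo%E).
  rewrite (eseries_pinfty _ _ ioo) ?leey// => k _.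
  by rewrite -ltNye (lt_le_trans _ (lam_ge0 _)).
rewrite -forallNE => Aoo.
apply/lee_addgt0Pr => e e0.
rewrite (le_trans _ (epsilon_trick _ _ (ltW e0)))//; last first.
  by move=> k; exact: lam_ge0.
pose P m (ab : (nat -> V) * (nat -> V)) :=
    A m `<=` \bigcup_k obox (ab.1 k) (ab.2 k) /\
    (\sum_(k <oo) (bvol (ab.1 k) (ab.2 k))%:E <=
      lam (A m) + (e / (2 ^ m.+1)%:R)%:E)%E.
have [G PG] : {G & forall m, P m (G m)}.
  apply: (@choice _ _ P) => m.
  have en1 : 0 < e / (2 ^ m.+1)%:R by rewrite divr_gt0// ltr0n expn_gt0.
  have fA : lam (A m) \is a fin_num.
    rewrite ge0_fin_numE ?lam_ge0// ltey; apply/eqP; exact: Aoo.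
  have [_ [ab /= Aab <-] abl] := lb_ereal_inf_adherent en1 fA.
  by exists ab; split => //; exact/ltW.
have /card_esym/ppcard_eqP[g] := card_nat2.
pose v (m : nat * nat) : \bar R := (bvol ((G m.1).1 m.2) ((G m.1).2 m.2))%:E.
have v0 m : (0 <= v m)%E by rewrite lee_fin bvol_ge0.
apply: (@le_trans _ _ (\esum_(i in setT) v i)).
  apply: ereal_inf_lbound => /=.
  exists (fun k => (G (g k).1).1 (g k).2, fun k => (G (g k).1).2 (g k).2) => /=.
    move=> x [m _ /(PG m).1 [k _ mkx]]; exists (g^-1%FUN (m, k)) => //=.
    by rewrite invK ?inE.
  rewrite nneseries_esumT; last by move=> k; rewrite lee_fin bvol_ge0.
  rewrite [RHS](reindex_esum setT setT g) //=; exact: bijTT.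
rewrite (_ : esum _ _ = \sum_(i <oo) \sum_(j <oo) v (i, j))%E; last first.
  rewrite nneseries_esumT; last first.
    by move=> k; apply: nneseries_ge0 => *; exact: v0.
  transitivity (\esum_(i in setT) \esum_(j in setT) v (i, j))%E; last first.
    by apply: eq_esum => i _; rewrite nneseries_esumT.
  rewrite esum_esum//; apply: congr2 => //.
  by apply/seteqP; split => // -[i j] _; split.
apply: lee_nneseries => // m _; first by move=> _; apply: nneseries_ge0 => *; exact: v0.
exact: (PG m).2.
Qed.

Lemma bvol_eq0 i a b : coord b i <= coord a i -> bvol a b = 0.
Proof.
move=> ba; rewrite /bvol (bigD1 i)//= (_ : Num.max _ _ = 0) ?mul0r//.
by apply: max_l; rewrite subr_le0.
Qed.

Lemma lam_le_bvol A a b : A `<=` obox a b -> (lam A <= (bvol a b)%:E)%E.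
Proof.
move=> Aab; apply: ereal_inf_lbound => /=.
(* The cover must be an infinite sequence, so it is padded with boxes whose two corners are 0. These
   have volume 0 because the dimension is [n.+1]; in dimension 0 the empty product would be 1. *)
exists (fun k : nat => if k is 0%N then a else 0 : V,
        fun k : nat => if k is 0%N then b else 0 : V).
  by move=> x /Aab abx; exists 0%N.
rewrite nneseries_recl//=; last by move=> k; rewrite lee_fin bvol_ge0.
rewrite eseries_cond/= eseries0 ?adde0// => -[|k]//= _ _.
by rewrite (@bvol_eq0 ord0).
Qed.

Lemma lam0 : lam (set0 : set V) = 0%E.
Proof.
apply/eqP; rewrite eq_le lam_ge0 andbT.
by apply: le_trans (@lam_le_bvol _ 0 0 _) _ => //; rewrite (@bvol_eq0 ord0).
Qed.

HB.instance Definition _ := isOuterMeasure.Build R V (@lam R n.+1)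
  lam0 lam_ge0 le_lam lam_sigma_subadditive.

(** The map [y |-> a + l *: y] carries a cover of [B] to a cover of [A] and multiplies each volume
    by [l ^ n.+1]. Used with [l] and with [l^-1], the inequality becomes an exact scaling law for
    cubes. *)
Lemma lam_affine A B a (l : R) : 0 < l ->
  (forall x, A x -> B (l^-1 *: (x - a))) -> (lam A <= (l ^+ n.+1)%:E * lam B)%E.
Proof.
move=> l0 AB; have ln0 : 0 < l ^+ n.+1 by rewrite exprn_gt0.
rewrite -lee_pdivrMl//; apply: le_ereal_inf_tmp => _ [ab /= Bab <-].
rewrite lee_pdivrMl// -nneseriesZl; last by move=> *; rewrite lee_fin bvol_ge0.
apply: ereal_inf_lbound => /=.
exists (fun k => a + l *: ab.1 k, fun k => a + l *: ab.2 k) => /=.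
  move=> x /AB /Bab[k _ kx]; exists k => // i; move: (kx i).
  rewrite /coord !mxE mulrC ltr_pdivlMr// ltr_pdivrMr//.
  by rewrite ltrBrDl ltrBlDl !(mulrC l).
apply: eq_eseriesr => k _; rewrite -EFinM; congr EFin.
rewrite [l ^+ _](_ : _ = \prod_(i < n.+1) l); last first.
  by rewrite prodr_const card_ord.
rewrite /bvol -big_split/=.
apply: eq_bigr => i _; rewrite /coord !mxE opprD addrACA subrr add0r -mulrBr.
by rewrite -[in LHS](mulr0 l) maxr_pMr// ltW.
Qed.

Definition upd a (i : 'I_n.+1) (c : R) : V :=
  \row_j if j == i then c else a ord0 j.

Lemma updE a i c j : coord (upd a i c) j = if j == i then c else coord a j.
Proof. by rewrite /coord mxE. Qed.

(** The hypotheses leave the hyperplane [coord x i = c] undecided, so open and closed half-spaces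
    are treated at once. Each box of a cover is cut at [c], and each piece is placed in an open box
    that may reach [d] beyond the cut. *)
Lemma lmeas_halfspace (i : 'I_n.+1) (c : R) (H : set V) :
  (forall x, coord x i < c -> H x) -> (forall x, H x -> coord x i <= c) ->
  lmeas H.
Proof.
move=> cH Hc; apply: le_caratheodory_measurable => E.
apply: le_ereal_inf_tmp => _ [[a b] /= Eab <-].
have box k : (lam (obox (a k) (b k) `&` H) +
     lam (obox (a k) (b k) `&` ~` H) <= (bvol (a k) (b k))%:E)%E.
  pose P := \prod_(j < n.+1 | j != i) Num.max 0 (coord (b k) j - coord (a k) j).
  have P0 : 0 <= P by apply: prodr_ge0 => j _; rewrite le_max lexx.
  (* The two overlapping boxes exceed the original volume by at most [2 * d * P]; [P + 1] keeps the
     denominator positive when [P] is 0. *)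
  apply/lee_addgt0Pr => e e0; pose d := e / (2 * (P + 1)).
  have d0 : 0 < d by rewrite divr_gt0// mulr_gt0// ltr_wpDl.
  have dP : 2 * d * P <= e.
    rewrite /d invfM !mulrA (mulrC 2) mulfK// mulrAC ler_pdivrMr ?ltr_wpDl//.
    by rewrite ler_wpM2l ?(ltW e0)// lerDl.
  pose b' := upd (b k) i (Num.min (coord (b k) i) (c + d)).
  pose a' := upd (a k) i (Num.max (coord (a k) i) (c - d)).
  apply: (@le_trans _ _ ((bvol (a k) b')%:E + (bvol a' (b k))%:E)%E).
    apply: leeD; apply: lam_le_bvol => x [] abx Hx j; have /andP[ax xb] := abx j.
      rewrite updE; case: eqP => [->|_]; last by rewrite ax xb.
      have /andP[-> xbi] := abx i; rewrite lt_min xbi/=.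
      by rewrite (le_lt_trans (Hc _ Hx))// ltrDl.
    rewrite updE; case: eqP => [->|_]; last by rewrite ax xb.
    have /andP[axi ->] := abx i; rewrite gt_max axi/= andbT.
    rewrite (@lt_le_trans _ _ c)// ?ltrBlDr ?ltrDl// leNgt.
    by apply/negP => /cH.
  rewrite -!EFinD lee_fin /bvol (bigD1 i)//= [X in _ + X](bigD1 i)//=.
  rewrite [X in _ <= X + _](bigD1 i)//= !updE eqxx.
  rewrite (@eq_bigr _ _ _ _ _ _ _
    (fun j => Num.max 0 (coord (b k) j - coord (a k) j))); last first.
    by move=> j /negPf ji; rewrite updE ji.
  rewrite -/P [X in _ + _ * X](_ : _ = P); last first.
    by apply: eq_bigr => j /negPf ji; rewrite updE ji.
  rewrite -/P -mulrDl; apply: le_trans (lerD (lexx _) dP); rewrite -mulrDl.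
  apply: ler_wpM2r => //.
  move: (coord (a k) i) (coord (b k) i) => u v.
  by rewrite /Num.max /Num.min; repeat case: ifPn; lra.
apply: (@le_trans _ _ (\sum_(k <oo) lam (obox (a k) (b k) `&` H) +
   \sum_(k <oo) lam (obox (a k) (b k) `&` ~` H))%E).
  by apply: leeD; (apply: le_trans (lam_sigma_subadditive _); apply: le_lam;
    rewrite -setI_bigcupl; exact: setSI).
rewrite -nneseriesD; try by move=> *; exact: lam_ge0.
by apply: lee_nneseries => // k _; move=> *; apply: adde_ge0; exact: lam_ge0.
Qed.

End outer_measure_lam.

(** * Measurable sets, measurable hulls and continuity from below *)

Lemma caratheodory_nondecreasing_cvg (R : realType) (T : pointedType)
    (mu : {outer_measure set T -> \bar R}) (G : nat -> set T) :
  (forall k, mu.-caratheodory (G k)) ->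
  {homo G : j k / (j <= k)%N >-> (j <= k)%O} ->
  mu (G k) @[k --> \oo] --> mu (\bigcup_k G k).
Proof.
move=> mG Gnd; apply: (@nondecreasing_cvg_mu _ (caratheodory_type mu) R mu G) => //.
exact: (@bigcupT_measurable _ (caratheodory_type mu)).
Qed.

Section measurable_sets.
Context {R : realType} {n : nat}.
Local Notation V := 'rV[R]_n.+1.
Local Notation coord := Defs.coord.
Local Notation T := (caratheodory_type (@lam R n.+1)).
Implicit Types (A B E : set V) (a b x y z : V).
Local Notation Q0 := (@Defs.Q0 R n.+1).

Lemma lmeasE A : lmeas A = (@lam R n.+1).-cara.-measurable A.
Proof. by []. Qed.

Lemma lmeas_obox a b : lmeas (obox a b).
Proof.
have -> : obox a b = \bigcap_(i in [set: 'I_n.+1])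
    (~` [set x | coord x i <= coord a i] `&` [set x | coord x i < coord b i]).
  apply/seteqP; split => x abx i.
    by move=> _; have /andP[ax xb] := abx i; split=> //=; apply/negP; rewrite -ltNge.
  by have [/= /negP] := abx i I; rewrite -ltNge => -> ->.
rewrite lmeasE; apply: fin_bigcap_measurable => [|i _]; first exact: finite_finset.
apply: measurableI.
  apply: (@measurableC _ T).
  by apply: (@lmeas_halfspace _ _ i (coord a i)) => // x /= /ltW.
by apply: (@lmeas_halfspace _ _ i (coord b i)) => // x /= /ltW.
Qed.

(** The hull is the intersection over [m] of open covers of total volume at most [lam A + 1 / m.+1];
    when [lam A] is infinite the whole space serves. *)
Lemma lmeas_hull A : exists H, [/\ lmeas H, A `<=` H & lam H = lam A].
Proof.
have [Aoo|Afin] := eqVneq (lam A) +oo%E.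
  exists setT; split => //; first exact: (@measurableT _ T).
  by apply/eqP; rewrite Aoo -leye_eq -Aoo le_lam.
have fA : lam A \is a fin_num by rewrite ge0_fin_numE ?lam_ge0// ltey.
have [G PG] : {G & forall m : nat,
    A `<=` \bigcup_k obox ((G m).1 k) ((G m).2 k) /\
    (\sum_(k <oo) (bvol ((G m).1 k) ((G m).2 k))%:E <= lam A + (m.+1%:R^-1)%:E)%E}.
  apply: (@choice _ _ (fun (m : nat) (ab : (nat -> V) * (nat -> V)) =>
    A `<=` \bigcup_k obox (ab.1 k) (ab.2 k) /\
    (\sum_(k <oo) (bvol (ab.1 k) (ab.2 k))%:E <= lam A + (m.+1%:R^-1)%:E)%E)) => m.
  have m0 : 0 < m.+1%:R^-1 :> R by rewrite invr_gt0.
  have [_ [ab /= Aab <-] abl] := lb_ereal_inf_adherent m0 fA.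
  by exists ab; split => //; exact/ltW.
exists (\bigcap_m \bigcup_k obox ((G m).1 k) ((G m).2 k)); split.
- apply: (@bigcapT_measurable _ T) => m; apply: (@bigcupT_measurable _ T) => k.
  exact: lmeas_obox.
- by move=> x Ax m _; exact: (PG m).1.
- apply/eqP; rewrite eq_le; apply/andP; split; last first.
    by apply: le_lam => x Ax m _; exact: (PG m).1.
  apply/lee_addgt0Pr => e e0.
  have [m me] : exists m : nat, m.+1%:R^-1 <= e.
    by exists (Num.truncn e^-1); rewrite invf_ple ?posrE// ltW// truncnS_gt.
  apply: le_trans (_ : lam A + (m.+1%:R^-1)%:E <= _)%E; last first.
    by rewrite leeD2l// lee_fin.
  apply: le_trans (PG m).2.
  apply: (@le_trans _ _ (lam (\bigcup_k obox ((G m).1 k) ((G m).2 k)))).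
    by apply: le_lam => x; apply.
  apply: le_trans (lam_sigma_subadditive _) _.
  apply: lee_nneseries => [k _ _|k _]; first exact: lam_ge0.
  exact: lam_le_bvol.
Qed.

(* No measurability is needed: replace each set by a measurable hull of the
   same measure, and then the k-th hull by the intersection of the later ones. *)
Lemma lam_nondecreasing_cvg (F : nat -> set V) :
  (forall j k, (j <= k)%N -> F j `<=` F k) ->
  lam (F k) @[k --> \oo] --> lam (\bigcup_k F k).
Proof.
move=> Fnd; have [H PH] := choice (fun k => lmeas_hull (F k)).
pose G k := \bigcap_(j in [set j | (k <= j)%N]) H j.
have FG k : F k `<=` G k.
  by move=> x Fx j /= kj; have [_ + _] := PH j; apply; exact: Fnd kj _ Fx.
have mG k : lmeas (G k).
  by apply: (@bigcap_measurableType _ T) => j _; have [] := PH j.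
have lG k : lam (G k) = lam (F k).
  apply/eqP; rewrite eq_le (le_lam (FG k)) andbT.
  by have [_ _ <-] := PH k; apply: le_lam => x; apply => /=.
have Gnd : {homo G : j k / (j <= k)%N >-> (j <= k)%O}.
  move=> j k jk; apply/subsetPset => x Gx i /= ki.
  by apply: Gx => /=; exact: leq_trans ki.
have cG : lam (G k) @[k --> \oo] --> lam (\bigcup_k G k).
  exact: (@caratheodory_nondecreasing_cvg _ _ (@lam R n.+1)).
have lFG : lam (\bigcup_k F k) = lam (\bigcup_k G k).
  apply/eqP; rewrite eq_le; apply/andP; split.
    by apply: le_lam; exact: subset_bigcup.
  rewrite -(cvg_lim _ cG)//; apply: lime_le; first by apply/cvg_ex; eexists; exact: cG.
  by apply: nearW => k; rewrite lG; apply: le_lam => x Fx; exists k.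
by rewrite lFG; under eq_fun do rewrite -lG.
Qed.

Lemma Q0_obox : Q0 = obox (0 : V) (const_mx 1).
Proof. by apply/seteqP; split => x + i => /(_ i); rewrite /Defs.coord !mxE. Qed.

Lemma lmeas_Q0 : lmeas Q0.
Proof. by rewrite Q0_obox; exact: lmeas_obox. Qed.

(** An open [U] is the union of the rational boxes it contains, and the preimage of a box under
    [y |-> (y, f y)] is a box in space intersected with two level sets of [f]. This allows a
    function of [(y, f y)] to be treated as if [f y] were an independent variable. *)
Lemma lmeas_graph_preimage (f : V -> R) (U : set (V * R)) :
  emeas (fun x => (f x)%:E) -> open U -> lmeas (Q0 `&` [set y | U (y, f y)]).
Proof.
move=> mf oU.
have mgt (c : R) : lmeas (Q0 `&` [set y | c < f y]) by exact: mf.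
have mlt (d : R) : lmeas (Q0 `&` [set y | f y < d]).
  (* [f y < d] means [f y <= q] for some rational [q < d]; for the other [q] the subtracted set is
     all of [Q0], so they contribute nothing. *)
  rewrite (_ : _ `&` _ = \bigcup_(q in [set: rat])
      (Q0 `\` (Q0 `&` (if ratr q < d then [set y | ratr q < f y] else setT)))).
    apply: (@countable_bigcupT_measurable _ T) => // q.
    apply: (@measurableD _ T); first exact: lmeas_Q0.
    case: ifPn => qd; first exact: mgt.
    by apply: (@measurableI _ T); [exact: lmeas_Q0|exact: (@measurableT _ T)].
  apply/seteqP; split => [y [Qy /= yd]|y [q _ [Qy]]].
    have [q] := rat_in_itvoo yd; rewrite in_itv/= => /andP[yq qd].
    by exists q => //; split => // -[_]; rewrite qd /= => /lt_geF; rewrite ltW.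
  rewrite /= => /not_andP[//|]; case: ifPn => [qd /negP|_ []//].
  by rewrite -leNgt => yq; split => //=; exact: le_lt_trans qd.
pose rv (a : 'rV[rat]_n.+1) : V := map_mx ratr a.
pose box (q : ('rV[rat]_n.+1 * 'rV[rat]_n.+1) * (rat * rat)) : set (V * R) :=
  [set ys | obox (rv q.1.1) (rv q.1.2) ys.1 /\ ratr q.2.1 < ys.2 < ratr q.2.2].
pose S (q : ('rV[rat]_n.+1 * 'rV[rat]_n.+1) * (rat * rat)) : set V :=
  if `[< box q `<=` U >] then
    obox (rv q.1.1) (rv q.1.2) `&` ((Q0 `&` [set y | ratr q.2.1 < f y]) `&`
      (Q0 `&` [set y | f y < ratr q.2.2]))
  else set0.
rewrite (_ : _ `&` _ = \bigcup_(q in setT) S q).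
  apply: (@countable_bigcupT_measurable _ T) => // q; rewrite /S.
  case: ifPn => _; last exact: (@measurable0 _ T).
  apply: (@measurableI _ T); first exact: lmeas_obox.
  by apply: (@measurableI _ T); [exact: mgt|exact: mlt].
apply/seteqP; split => [y [Qy /= Uy]|y [q _]]; last first.
  rewrite /S; case: asboolP => // qU [yq [[Qy fy] [_ fy']]].
  by split => //; apply: qU; split => //=; apply/andP.
have [e /= e0 eU] : exists2 e : R, 0 < e & ball (y, f y) e `<=` U.
  by apply/nbhs_ballP; exact: open_nbhs_nbhs.
have ratI (u v : R) : u < v -> exists q : rat, u < ratr q < v.
  by move=> /rat_in_itvoo[q]; rewrite in_itv/= => quv; exists q.
(* Rational endpoints within [e] on either side of each coordinate and of [f y]: the box they bound
   stays in the ball of radius [e], since balls are taken coordinatewise. *)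
have lo (u : R) : exists q : rat, u - e < ratr q < u.
  by apply: ratI; rewrite ltrBlDr ltrDl.
have hi (u : R) : exists q : rat, u < ratr q < u + e.
  by apply: ratI; rewrite ltrDl.
have [l Pl] := choice lo; have [h Ph] := choice hi.
exists ((\row_j l (coord y j), \row_j h (coord y j)), (l (f y), h (f y))) => //.
have [/andP[_ fl] /andP[hf _]] := (Pl (f y), Ph (f y)).
rewrite /S; case: asboolP => [_|]; last first.
  case; move=> [z s] /= [zb sb]; apply: eU.
  have near1 (u w : R) : ratr (l u) < w -> w < ratr (h u) -> `|u - w| < e.
    have [/andP[lu _] /andP[_ hu]] := (Pl u, Ph u) => uw wu.
    by rewrite ltr_norml; apply/andP; split; lra.
  split => /=; last by move/andP: sb => [? ?]; exact: near1.
  split=> // i j; rewrite (ord1 i); have /andP[] := zb j.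
  by rewrite /rv /Defs.coord !mxE; exact: near1.
split; last by split; split.
move=> j; rewrite /rv /Defs.coord !mxE.
by have [/andP[_ ->] /andP[-> _]] := (Pl (y ord0 j), Ph (y ord0 j)).
Qed.

End measurable_sets.

(** * Calculus of the layer-cake integral *)

Lemma nonincreasing_emeasurable (R : realType) (D : set R) (g : R -> \bar R) :
  measurable D -> (forall s t, s <= t -> (g t <= g s)%E) -> measurable_fun D g.
Proof.
move=> mD g_ni; apply: measurable_funS (@measurableT _ _) _ _ => //.
apply: (measurability _ (ErealGenOInfty.measurableE R)).
move=> /= _ [_ [a ->]] <-; rewrite setTI preimage_itvoy.
apply: is_interval_measurable => s t /= sa ta u /andP[su ut].
exact: lt_le_trans ta (g_ni _ _ ut).
Qed.

(** Lebesgue measure is [c^-1] times its image under [t |-> t / c], by uniqueness from the values on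
    half-open intervals. This yields the homogeneity of [lint]. *)
Lemma ge0_integral_halfline_scale (R : realType) (c : R) (g : R -> \bar R) :
  0 < c -> measurable_fun (`]0%R, +oo[%classic : set R) g -> (forall t, 0 <= g t)%E ->
  (\int[@lebesgue_measure R]_(t in `]0%R, +oo[) g (t / c)%R =
   c%:E * \int[@lebesgue_measure R]_(t in `]0%R, +oo[) g t)%E.
Proof.
move=> c0 mg g0; pose phi (t : measurableTypeR R) : measurableTypeR R := t / c.
have mphi : measurable_fun setT phi.
  by apply: continuous_measurable_fun => x; apply: cvgMl; exact: cvg_id.
have ic0 : 0 <= c^-1 by rewrite invr_ge0 ltW.
pose pushm := (pushforward (@lebesgue_measure R) phi :
  {measure set (measurableTypeR R) -> \bar R}).
pose push := pushm mphi.
have pushE : push = pushforward (@lebesgue_measure R) phi :> (set _ -> \bar R) by [].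
pose mu := mscale (NngNum ic0) push.
have lmu (A : set (measurableTypeR R)) : measurable A -> lebesgue_measure A = mu A.
  apply: lebesgue_measure_unique => _ [[a b] _ <-].
  rewrite [RHS](_ : _ = (c^-1)%:E * lebesgue_measure (phi @^-1` `]a, b]%classic))%E//.
  rewrite (_ : phi @^-1` _ = `](a * c)%R, (b * c)%R]%classic).
    rewrite !lebesgue_measure_itv/= !lte_fin ltr_pM2r//.
    case: ifPn => _; last by rewrite mule0.
    by rewrite -!EFinB -EFinM; congr EFin; field; rewrite gt_eqF.
  apply/seteqP; split => x /=; rewrite /phi !in_itv/=;
    by rewrite ltr_pdivlMr// ler_pdivrMr.
have phi_itv : phi @^-1` `]0%R, +oo[%classic = `]0%R, +oo[%classic.
  by apply/seteqP; split => x /=; rewrite /phi !in_itv/= !andbT ltr_pdivlMr// mul0r.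
transitivity (\int[push]_(t in `]0%R, +oo[) g t)%E.
  rewrite pushE (ge0_integral_pushforward mphi lebesgue_measure)//.
  by rewrite phi_itv.
rewrite [in RHS](_ : \int[@lebesgue_measure R]_(t in `]0%R, +oo[) g t =
    \int[mu]_(t in `]0%R, +oo[) g t)%E; last first.
  by apply: eq_measure_integral => A mA _; exact: lmu.
by rewrite ge0_integral_mscale//= muleA -EFinM divff ?gt_eqF// mul1e.
Qed.

Section lint.
Context {R : realType} {n : nat}.
Local Notation V := 'rV[R]_n.+1.
Implicit Types (A B E N : set V) (F G : V -> \bar R).
Local Open Scope ereal_scope.

Lemma lamU2 A B : lam (A `|` B) <= lam A + lam B.
Proof. exact: (outer_measureU2 (@lam R n.+1)). Qed.

(** The distribution function is nonincreasing in [t], so the integrand of [lint] is measurable for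
    arbitrary [A] and [F]. *)
Lemma measurable_levels A F (D : set R) : measurable D ->
  measurable_fun D (fun t : R => lam (A `&` [set x | t%:E < F x])).
Proof.
move=> mD; apply: nonincreasing_emeasurable => // s t st.
apply: le_lam => x [Ax /=] tx; split => //=.
by apply: le_lt_trans tx; rewrite lee_fin.
Qed.

Lemma lint_ge0 A F : 0 <= lint A F.
Proof. by apply: integral_ge0 => t _; exact: lam_ge0. Qed.

(** Each level set of [F] lies in that of [G] up to [N], which subadditivity absorbs. *)
Lemma le_lint_ae A B F G N : lam N = 0 -> A `<=` B ->
  (forall x, A x -> ~ N x -> F x <= G x) -> lint A F <= lint B G.
Proof.
move=> N0 AB FG; apply: ge0_le_integral => //=; try exact: measurable_levels.
- by move=> t _; exact: lam_ge0.
- move=> t _; apply: (@le_trans _ _ (lam ((B `&` [set x | t%:E < G x]) `|` N))).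
    apply: le_lam => x [Ax /= tx]; have [Nx|Nx] := pselect (N x); [by right|left].
    by split; [exact: AB|exact: lt_le_trans (FG _ Ax Nx)].
  by apply: le_trans (lamU2 _ _) _; rewrite N0 adde0.
Qed.

Lemma le_lint A B F G : A `<=` B -> (forall x, A x -> F x <= G x) ->
  lint A F <= lint B G.
Proof. by move=> AB FG; apply: (le_lint_ae lam0 AB) => x Ax _; exact: FG. Qed.

Lemma lint0 A : lint A (fun=> 0) = 0.
Proof.
apply: integral0_eq => t /=; rewrite in_itv/= andbT => t0.
rewrite (_ : _ `&` _ = set0) ?lam0// -subset0 => x [_ /=].
by rewrite lte_fin ltNge ltW.
Qed.

Lemma lint_cst_ge A (v : \bar R) : 0 <= v -> v * lam A <= lint A (fun=> v).
Proof.
move=> v0.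
have cst_lt (r : R) : (0 < r)%R -> r%:E <= v -> r%:E * lam A <= lint A (fun=> v).
  move=> r0 rv; apply: (@le_trans _ _
      (\int[@lebesgue_measure R]_(t in `]0%R, r[) (cst (lam A) t))).
    rewrite integral_cst//= lebesgue_measure_itv/= lte_fin r0.
    by rewrite sube0 muleC.
  apply: (@le_trans _ _ (\int[@lebesgue_measure R]_(t in `]0%R, r[)
      lam (A `&` [set x | t%:E < v]))).
    apply: ge0_le_integral => //=.
    - by move=> *; exact: lam_ge0.
    - exact: measurable_levels.
    - move=> t; rewrite in_itv/= => /andP[_ tr]; apply: le_lam => x Ax; split => //=.
      by apply: lt_le_trans rv; rewrite lte_fin.
  apply: ge0_subset_integral => //=; first exact: measurable_levels.
    by move=> *; exact: lam_ge0.
  by move=> t /=; rewrite !in_itv/= andbT => /andP[].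
case: v v0 cst_lt => [r| |//].
  rewrite lee_fin le_eqVlt => /predU1P[<-|r0]; first by rewrite mul0e lint_ge0.
  by move=> /(_ r r0); apply.
(* Here [v] is infinite: the level [r / lam A] gives the lower bound [r] for every [r > 0], and if
   [lam A] is infinite the level 1 is enough. *)
move=> _ cst_lt; have := lam_ge0 A; rewrite le_eqVlt => /predU1P[<-|A0].
  by rewrite mule0 lint_ge0.
rewrite gt0_mulye// leye_eq; apply/eqP/eqyP => r r0.
case: (lam A) A0 cst_lt => [a| |//] A0 cst_lt.
  have := cst_lt (r / a)%R; rewrite -EFinM divfK; last by rewrite gt_eqF.
  by apply; rewrite ?leey// divr_gt0.
by apply: le_trans (cst_lt 1%R ltr01 (leey _)); rewrite mul1e leey.
Qed.

(** The pointwise hypothesis says that [G] is at most the maximum of [s] and [F]: levels below [s]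
    cost at most [lam A] each, and levels from [s] on are those of [F]. This takes the place of
    subadditivity of the integral against a constant. *)
Lemma lint_max A (s : R) F G : (0 <= s)%R ->
  (forall x, A x -> G x <= s%:E \/ G x <= F x) ->
  lint A G <= s%:E * lam A + lint A F.
Proof.
move=> s0 GF.
have ms : measurable_fun (`]0%R, +oo[%classic : set R)
    (fun t : R => if (t < s)%R then lam A else 0).
  apply: nonincreasing_emeasurable => // u t ut.
  case: ifPn => ts; first by rewrite (le_lt_trans ut ts).
  by case: ifPn => // _; exact: lam_ge0.
have -> : s%:E * lam A = \int[@lebesgue_measure R]_(t in `]0%R, +oo[)
    (if (t < s)%R then lam A else 0).
  have -> : s%:E * lam A = \int[@lebesgue_measure R]_(t in `]0%R, s[) (cst (lam A) t).
    rewrite integral_cst//= lebesgue_measure_itv/= lte_fin muleC.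
    case: ltgtP s0 => // [_ _|<- _]; [by rewrite sube0|by rewrite mule0].
  rewrite integral_mkcond [RHS]integral_mkcond; apply: eq_integral => t _.
  rewrite /patch /= !mem_setE !in_itv/= andbT.
  by case: (0 < t)%R; case: (t < s)%R.
rewrite -ge0_integralD//=; first last.
- exact: measurable_levels.
- by move=> *; exact: lam_ge0.
- by move=> t _; case: ifPn => // _; exact: lam_ge0.
apply: ge0_le_integral => //=.
- by move=> *; exact: lam_ge0.
- exact: measurable_levels.
- by apply: emeasurable_funD => //; exact: measurable_levels.
- move=> t _; case: ifPn => [ts|st].
    apply: le_trans (leeDl _ (lam_ge0 _)); apply: le_lam; exact: subIsetl.
  rewrite add0e; apply: le_lam => x [Ax /= tx]; split => //=.
  case: (GF _ Ax) => [Gs|]; last exact: lt_le_trans.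
  by have := lt_le_trans tx Gs; rewrite lte_fin (negbTE st).
Qed.

Lemma lintZ A (c : R) F : (0 < c)%R -> lint A (fun x => c%:E * F x) = c%:E * lint A F.
Proof.
move=> c0; rewrite /lint -ge0_integral_halfline_scale//=; last 2 first.
- exact: measurable_levels.
- by move=> t; exact: lam_ge0.
apply: eq_integral => t _; congr (lam (A `&` _)).
by apply/seteqP; split => x /=; rewrite -lte_pdivrMl// -EFinM (mulrC _ t).
Qed.

(** Continuity of [lam] along increasing sets gives convergence at each level [t], and monotone
    convergence in [t] does the rest. The conclusion has the shape that lower semicontinuity asks
    for. *)
Lemma lint_nondecreasing_cvg A F (Fk : nat -> V -> \bar R) :
  (forall x j k, A x -> (j <= k)%N -> Fk j x <= Fk k x) ->
  (forall x (t : R), A x -> t%:E < F x -> exists k, t%:E < Fk k x) ->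
  forall r, r < lint A F -> exists k, r < lint A (Fk k).
Proof.
move=> Fnd FF r rF; pose L k (t : R) := lam (A `&` [set x | t%:E < Fk k x]).
have cL (t : R) : L k t @[k --> \oo] -->
    lam (\bigcup_k (A `&` [set x | t%:E < Fk k x])).
  apply: (@lam_nondecreasing_cvg R n (fun k => A `&` [set x | t%:E < Fk k x])).
  move=> j k jk x [Ax /= tx]; split => //=; exact: lt_le_trans (Fnd _ _ _ Ax jk).
have L0 k t : 0 <= L k t by exact: lam_ge0.
have Lnd t : {homo L^~ t : j k / (j <= k)%N >-> j <= k}.
  move=> j k jk; apply: le_lam => x [Ax /= tx]; split => //=.
  exact: lt_le_trans (Fnd _ _ _ Ax jk).
have := @cvg_monotone_convergence _ _ R lebesgue_measure `]0%R, +oo[%classic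
  (measurable_itv _) L (fun k => measurable_levels _ _ (measurable_itv _))
  (fun k t _ => L0 k t) (fun t _ => Lnd t).
set I := (X in _ --> X) => cI.
have FI : lint A F <= I.
  apply: ge0_le_integral => //=.
  - by move=> *; exact: lam_ge0.
  - exact: measurable_levels.
  - apply: nonincreasing_emeasurable => // s t st.
    rewrite (cvg_lim _ (cL s))// (cvg_lim _ (cL t))//.
    apply: le_lam; apply: subset_bigcup => k _ x [Ax /= tx]; split => //=.
    by apply: le_lt_trans tx; rewrite lee_fin.
  - move=> t _; rewrite (cvg_lim _ (cL t))//; apply: le_lam => x [Ax /= tx].
    by have [k ?] := FF _ _ Ax tx; exists k.
apply: contrapT => /forallNP Nk.
have : I <= r.
  rewrite -(cvg_lim _ cI)//; apply: lime_le; first by apply/cvg_ex; exists I.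
  by apply: nearW => k; rewrite leNgt; apply/negP; exact: Nk.
by rewrite leNgt (lt_le_trans rF FI).
Qed.

(** The infima of [K] over balls of radius [1 / k.+1] around [w] increase with [k], and by
    semicontinuity they climb to [K w]. Once the integral of one such infimum exceeds [r], so does
    the integral at every point of that ball. *)
Lemma lint_lower_semicontinuous (W : pseudoMetricType R) A (K : W -> V -> \bar R) :
  (forall x, A x -> lower_semicontinuous (fun w => K w x)) ->
  lower_semicontinuous (fun w => lint A (K w)).
Proof.
move=> Klsc w r rK; pose U k := ball w (k.+1%:R^-1 : R).
have Unbhs k : nbhs w (U k) by apply: nbhsx_ballx; rewrite invr_gt0.
pose Fk k x := ereal_inf [set K v x | v in U k].
have [||k rk] := @lint_nondecreasing_cvg A (K w) Fk _ _ _ rK.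
- move=> x i j _ ij; apply: ereal_inf_le_tmp => _ [v Uv <-]; exists v => //.
  by apply: le_ball Uv; rewrite lef_pV2 ?posrE// ler_nat ltnS.
- move=> x t Ax tK.
  (* Passing to the infimum over a ball only preserves weak inequalities, hence the intermediate
     level [s]. *)
  have [s ts sK] : exists2 s : R, (t < s)%R & s%:E < K w x.
    case: (K w x) tK => [u| |//].
      by rewrite lte_fin => tu; exists ((t + u) / 2)%R; rewrite ?lte_fin; lra.
    by exists (t + 1)%R; [rewrite ltrDl|rewrite ltey].
  have [S wS SK] := Klsc x Ax w s sK.
  have [e /= e0 eS] : exists2 e : R, (0 < e)%R & ball w e `<=` S by exact/nbhs_ballP.
  exists (Num.truncn e^-1); apply: (@lt_le_trans _ _ s%:E); first by rewrite lte_fin.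
  apply: le_ereal_inf_tmp => _ [v Uv <-]; apply/ltW/SK/eS; apply: le_ball Uv.
  by rewrite invf_ple ?posrE// ltW// truncnS_gt.
- exists (U k) => // v Uv; apply: lt_le_trans rk _; apply: le_lint => // x Ax.
  by apply: ereal_inf_lbound; exists v.
Qed.

End lint.

(** * Lower semicontinuous kernels; measurability of the potential and of [Dpa] *)

Lemma powR_continuous (R : realType) (r x : R) :
  0 < x -> {for x, continuous (fun y => y `^ r)}.
Proof.
move=> x0; apply: differentiable_continuous; apply/derivable1_diffP.
by apply: derivable_powR; rewrite in_itv/= x0.
Qed.

Lemma continuous_nbhs_gt (R : realType) (T : topologicalType) (h : T -> R)
    (w : T) (a : R) :
  {for w, continuous h} -> a < h w -> nbhs w [set v | a < h v].
Proof. by move=> hc; exact: (cvgr_gt (h w)). Qed.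

Section kernels.
Context {R : realType} {n : nat}.
Local Notation V := 'rV[R]_n.+1.
Local Notation coord := Defs.coord.
Local Notation edist := Defs.edist.
Local Notation Q0 := (@Defs.Q0 R n.+1).
Implicit Types (A B E N : set V) (F G : V -> \bar R) (x y z : V).

Lemma edistC x y : edist x y = edist y x.
Proof. by congr Num.sqrt; apply: eq_bigr => i _; rewrite -sqrrN opprB. Qed.

Lemma edist_ge0 x y : 0 <= edist x y. Proof. exact: sqrtr_ge0. Qed.

Lemma edist_gt0 x y : x <> y -> 0 < edist x y.
Proof.
move=> xy; have [i xyi] : exists i, coord x i != coord y i.
  apply: contrapT => /forallNP e; apply: xy; apply/rowP => i.
  by apply/eqP/negPn/negP/e.
rewrite sqrtr_gt0 (bigD1 i)//= ltr_pwDl//.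
  by rewrite exprn_even_gt0//= subr_eq0.
by apply: sumr_ge0 => j _; exact: sqr_ge0.
Qed.

Lemma edist_le x y (l : R) : 0 <= l -> (forall i, `|coord x i - coord y i| <= l) ->
  edist x y <= Num.sqrt n.+1%:R * l.
Proof.
move=> l0 xyl; apply: (@le_trans _ _ (Num.sqrt (n.+1%:R * l ^+ 2))); last first.
  by rewrite sqrtrM// sqrtr_sqr ger0_norm.
apply: ler_wsqrtr; rewrite mulr_natl -[n.+1 in leRHS]card_ord -sumr_const.
by apply: ler_sum => i _; rewrite -real_normK ?num_real// lerXn2r ?nnegrE.
Qed.

Lemma edist_continuous y : continuous (fun x => edist x y).
Proof.
move=> x; apply: continuous_comp; last exact: sqrt_continuous.
apply: (continuous_big add_continuous) => i _ {}x.
apply: (@continuous_comp _ _ _ (fun x : V => coord x i - coord y i)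
  (fun u => u ^+ 2)); last exact: exprn_continuous.
apply: (@continuousB _ _ _ (fun x : V => coord x i) (fun=> coord y i) x).
  exact: (@coord_continuous _ _ _ ord0 i x).
exact: cst_continuous.
Qed.

Lemma powR_gt0_base (u r : R) : r != 0 -> 0 <= u -> 0 < u `^ r -> 0 < u.
Proof.
by move=> r0; rewrite le_eqVlt => /predU1P[<-|//]; rewrite powR0// ltxx.
Qed.

(* The convention [0 `^ r = 0] for [r < 0] makes the kernel vanish on the
   diagonal, which keeps it lower semicontinuous there. *)
Lemma riesz_kernel_lsc (r : R) (v : \bar R) y : r != 0 -> (0 <= v)%E ->
  lower_semicontinuous (fun z => (v * (edist z y `^ r)%:E)%E).
Proof.
move=> r0 v0 z a az; have [a0|a0] := ltP a 0.
  exists setT; first exact: filterT.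
  by move=> w _; rewrite (@lt_le_trans _ _ 0%E)// mule_ge0// lee_fin powR_ge0.
have kz : 0 < edist z y `^ r.
  rewrite lt_neqAle powR_ge0 andbT; apply: contraTneq az => <-.
  by rewrite mule0 -leNgt lee_fin.
have ez := powR_gt0_base r0 (edist_ge0 z y) kz.
have kc : {for z, continuous (fun w => edist w y `^ r)}.
  apply: (@continuous_comp _ _ _ (fun w : V => edist w y) (fun u => u `^ r)).
    exact: edist_continuous.
  exact: powR_continuous.
case: v v0 az => [v| |//]; last first.
  move=> _ _; exists [set w | 0 < edist w y `^ r]; first exact: continuous_nbhs_gt.
  by move=> w /= w0; rewrite gt0_mulye ?lte_fin// ltry.
rewrite lee_fin => v0; rewrite -EFinM lte_fin => az.
exists [set w | a < v * edist w y `^ r]; last by move=> w.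
apply: (@continuous_nbhs_gt _ _ (fun w : V => v * edist w y `^ r)) => //.
by apply: (@continuousM _ _ (fun=> v)) => //; exact: cst_continuous.
Qed.

(** The quotient is nonnegative, so only levels [a >= 0] matter; where it exceeds such a level,
    numerator and denominator are both nonzero and it is continuous. On the diagonal division by 0
    makes it vanish. *)
Lemma diff_quotient_lsc (p q : R) (c : R) x : 0 < p -> 0 < q ->
  lower_semicontinuous
    (fun w : V * R => (`|c - w.2| `^ p / edist x w.1 `^ q)%:E).
Proof.
move=> p0 q0 [y s] a /=; rewrite lte_fin => az; have [a0|a0] := ltP a 0.
  exists setT; first exact: filterT.
  by move=> w _; rewrite (@lt_le_trans _ _ 0%E)// lee_fin divr_ge0// powR_ge0.
have az0 := le_lt_trans a0 az.
have e0 : 0 < edist x y.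
  apply: (powR_gt0_base (lt0r_neq0 q0)); first exact: edist_ge0.
  rewrite lt_neqAle powR_ge0 andbT; apply: contraTneq az0 => <-.
  by rewrite invr0 mulr0 ltxx.
have c0 : 0 < `|c - s|.
  apply: (powR_gt0_base (lt0r_neq0 p0)) => //.
  rewrite lt_neqAle powR_ge0 andbT; apply: contraTneq az0 => <-.
  by rewrite mul0r ltxx.
exists [set w : V * R | a < `|c - w.2| `^ p / edist x w.1 `^ q]; last by move=> w.
pose num (w : V * R) := `|c - w.2| `^ p; pose den (w : V * R) := edist x w.1 `^ q.
apply: (@continuous_nbhs_gt _ _ (fun w => num w / den w)) => //.
apply: (@continuousM _ _ num (fun w => (den w)^-1)).
  apply: (@continuous_comp _ _ _ (fun w : V * R => `|c - w.2|) (fun u => u `^ p)).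
    apply: (@continuous_comp _ _ _ (fun w : V * R => c - w.2) Num.norm).
      apply: (@continuousB _ _ _ (fun=> c) (fun w : V * R => w.2)).
        exact: cst_continuous.
      by move=> ?; exact: cvg_snd.
    exact: norm_continuous.
  exact: powR_continuous.
apply: continuousV; first by rewrite gt_eqF// powR_gt0.
apply: (@continuous_comp _ _ _ (fun w : V * R => edist x w.1) (fun u => u `^ q)).
  rewrite (_ : (fun w : V * R => edist x w.1) = (fun u => edist u x) \o fst).
    by apply: continuous_comp; [by move=> ?; exact: cvg_fst|exact: edist_continuous].
  by apply/funext => w /=; rewrite edistC.
exact: powR_continuous.
Qed.

Lemma lmeas_openI (U : set V) : open U -> lmeas (Q0 `&` U).
Proof.
move=> oU; have := @lmeas_graph_preimage R n (fun=> 0) (fst @^-1` U) _ _; apply.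
  move=> t; have [t0|t0] := ltP t 0.
    rewrite (_ : _ `&` _ = Q0); first exact: lmeas_Q0.
    by apply/seteqP; split => [x []//|x Qx]; split => //=; rewrite lte_fin.
  rewrite (_ : _ `&` _ = set0).
    exact: (@measurable0 _ (caratheodory_type (@lam R n.+1))).
  by rewrite -subset0 => x [_ /=]; rewrite lte_fin ltNge t0.
by apply: open_comp => // w _; by move=> ?; exact: cvg_fst.
Qed.

Lemma lsc_emeas F : lower_semicontinuous F -> emeas F.
Proof. by move=> /lower_semicontinuousP Flsc t; exact: lmeas_openI. Qed.

Lemma riesz_emeas (alpha : R) F : alpha < n.+1%:R ->
  (forall x, Q0 x -> (0 <= F x)%E) -> emeas (riesz alpha F).
Proof.
move=> an F0; apply: lsc_emeas.
apply: (@lint_lower_semicontinuous _ _ V Q0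
  (fun z y => (F y * (edist z y `^ (alpha - n.+1%:R))%:E)%E)) => y Qy.
by apply: riesz_kernel_lsc; [rewrite subr_eq0 lt_eqF|exact: F0].
Qed.

Lemma riesz_ge0 (alpha : R) F z : (0 <= riesz alpha F z)%E.
Proof. exact: lint_ge0. Qed.

Lemma Dpa_ge0 (alpha p : R) f y : (0 <= Dpa alpha p f y)%E.
Proof. exact: poweR_ge0. Qed.

(** Replacing [f y] by a free variable gives a lower semicontinuous [J] on the product space, and
    [Dpa] exceeds [t >= 0] at [y] exactly when [J (y, f y)] exceeds the [p]-th power of [t]. *)
Lemma Dpa_emeas (alpha p : R) (f : V -> R) : 0 < alpha -> 0 < p ->
  emeas (fun x => (f x)%:E) -> emeas (Dpa alpha p f).
Proof.
move=> alpha0 p0 mf t; have [t0|t0] := ltP t 0.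
  rewrite (_ : _ `&` _ = Q0); first exact: lmeas_Q0.
  apply/seteqP; split => [x []//|x Qx]; split => //=.
  by apply: lt_le_trans (Dpa_ge0 _ _ _ _); rewrite lte_fin.
pose J (w : V * R) := lint Q0 (fun x =>
  (`|f x - w.2| `^ p / edist x w.1 `^ (n.+1%:R + alpha * p))%:E).
have q0 : 0 < n.+1%:R + alpha * p by rewrite addr_gt0// mulr_gt0.
have Jlsc : lower_semicontinuous J.
  apply: (@lint_lower_semicontinuous _ _ (V * R)%type Q0 (fun w x =>
    (`|f x - w.2| `^ p / edist x w.1 `^ (n.+1%:R + alpha * p))%:E)) => x _.
  exact: diff_quotient_lsc.
have /lower_semicontinuousP/(_ (t `^ p)) oJ := Jlsc.
rewrite (_ : _ `&` _ = Q0 `&` [set y | ((t `^ p)%:E < J (y, f y))%E]).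
  exact: lmeas_graph_preimage mf oJ.
congr (Q0 `&` _).
have ip : 0 < p^-1 by rewrite invr_gt0.
have le_poweR (r : R) (u v : \bar R) : 0 < r -> (0 <= u)%E -> (u <= v)%E ->
    (u `^ r <= v `^ r)%E.
  move=> r0 u0 uv; apply: gt0_ler_poweR => //; first exact: ltW.
    by rewrite in_itv/= u0 leey.
  by rewrite in_itv/= leey (le_trans u0).
apply/seteqP; split => y /=; rewrite /Dpa !ltNge; apply: contra => h.
  have := le_poweR _ _ _ ip (lint_ge0 _ _) h.
  by rewrite poweR_EFin -powRrM divff ?gt_eqF// powRr1.
have := le_poweR _ _ _ p0 (poweR_ge0 _ _) h.
rewrite -poweRrM mulVf ?gt_eqF// poweRe1 ?poweR_EFin//.
exact: lint_ge0.
Qed.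

End kernels.

(** * Estimates on a single cube *)

Lemma ge1_le_powR (R : realType) (u p : R) : 1 <= u -> 1 <= p -> u <= u `^ p.
Proof.
move=> u1 p1; rewrite -[leLHS]powRr1; last exact: le_trans u1.
exact: ler_powR.
Qed.

Lemma neg_powR_anti (R : realType) (u v r : R) : 0 < u -> u <= v -> r <= 0 ->
  v `^ r <= u `^ r.
Proof.
move=> u0 uv r0; have v0 : 0 < v by exact: lt_le_trans uv.
rewrite -[r]opprK !(powRN _ (- r)) lef_pV2 ?posrE ?powR_gt0//.
by apply: ge0_ler_powR; rewrite ?nnegrE ?oppr_ge0// ltW.
Qed.

Section cubes.
Context {R : realType} {n : nat}.
Local Notation V := 'rV[R]_n.+1.
Local Notation coord := Defs.coord.
Local Notation edist := Defs.edist.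
Local Notation Q0 := (@Defs.Q0 R n.+1).
Local Notation diam := (Num.sqrt (n.+1%:R : R)).
Implicit Types (A B E N : set V) (F G : V -> \bar R) (a x y z : V) (l : R).

Lemma diam_gt0 : 0 < diam. Proof. by rewrite sqrtr_gt0. Qed.

Lemma lam_Q0_le1 : (lam Q0 <= 1)%E.
Proof.
rewrite Q0_obox; apply: le_trans (@lam_le_bvol _ _ _ 0 (const_mx 1) _) _ => //.
rewrite /bvol big1// => i _.
by rewrite /Defs.coord !mxE subr0; apply: max_r.
Qed.

Lemma lam_ocube a l : 0 < l -> lam (ocube a l) = ((l ^+ n.+1)%:E * lam Q0)%E.
Proof.
move=> l0; apply/eqP; rewrite eq_le; apply/andP; split.
  apply: (@lam_affine _ _ _ _ a) => // x ax i; have /andP[ai ia] := ax i.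
  move: ai ia; rewrite /Defs.coord !mxE => ai ia.
  by rewrite mulrC divr_gt0 ?subr_gt0//= ltr_pdivrMr// mul1r ltrBlDl.
rewrite -lee_pdivlMl ?exprn_gt0// -exprVn.
apply: (@lam_affine _ _ _ _ (- l^-1 *: a)); first by rewrite invr_gt0.
move=> x Qx i; have /andP[] := Qx i; rewrite /Defs.coord !mxE => x0 x1.
rewrite invrK mulNr opprK mulrDr mulVKf ?gt_eqF//.
by rewrite ltrDr mulr_gt0//= addrC ltrD2l gtr_pMr.
Qed.

Lemma lam_ocube_le a l : 0 < l -> (lam (ocube a l) <= (l ^+ n.+1)%:E)%E.
Proof.
move=> l0; rewrite lam_ocube// -[leRHS]mule1; apply: lee_wpmul2l.
  by rewrite lee_fin exprn_ge0 ?ltW.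
exact: lam_Q0_le1.
Qed.

(* The point is fixed by a contraction, which scales [lam] by a factor < 1. *)
Lemma lam_set1 z : lam [set z] = 0%E.
Proof.
have fz : lam [set z] \is a fin_num.
  rewrite ge0_fin_numE ?lam_ge0//.
  apply: le_lt_trans (@lam_le_bvol _ _ _ (z - const_mx 1) (z + const_mx 1) _) (ltry _).
  by move=> _ -> i; rewrite /Defs.coord !mxE; apply/andP; split; lra.
have := @lam_affine R n [set z] [set z] (2^-1 *: z) 2^-1.
rewrite invr_gt0 ltr0n => /(_ isT).
have zz x : [set z] x -> [set z] (2^-1^-1 *: (x - 2^-1 *: z)).
  move=> ->; rewrite /= -{1}[z]scale1r -scalerBl scalerA.
  by rewrite (_ : _ * _ = 1) ?scale1r//; field.
move=> /(_ zz); have := lam_ge0 [set z]; case: (lam [set z]) fz => [r| |]// _.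
rewrite -EFinM !lee_fin => r0 rr; congr EFin; apply/eqP; rewrite eq_le r0 andbT.
have h : 2^-1 ^+ n.+1 <= 2^-1 :> R.
  by rewrite exprS ger_pMr ?invr_gt0// exprn_ile1 ?invr_ge0// invf_le1// ler1n.
have := ler_wpM2r r0 h; lra.
Qed.

Lemma edist_ocube a l x y : 0 < l -> ocube a l x -> ocube a l y ->
  edist x y <= diam * l.
Proof.
move=> l0 ax ay; apply: edist_le; first exact: ltW.
move=> i; have /andP[? ?] := ax i; have /andP[? ?] := ay i.
by rewrite ler_norml; apply/andP; split; lra.
Qed.

(* Hölder's inequality up to the factor 2: split according to whether
   [`|f x - f y|] exceeds a level [s], then choose [s] proportional to
   [Dpa alpha p f y]. *)
Lemma lint_ocube_diff (alpha p : R) (f : V -> R) a l y :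
  0 < alpha -> 1 < p -> 0 < l -> ocube a l `<=` Q0 -> ocube a l y ->
  (lint (ocube a l) (fun x => `|f x - f y|%:E) <=
   (2 * diam `^ ((n.+1%:R + alpha * p) / p) * l `^ alpha * l ^+ n.+1)%:E *
     Dpa alpha p f y)%E.
Proof.
move=> alpha0 p1 l0 aQ ay; have p0 : 0 < p by exact: lt_trans p1.
set q := n.+1%:R + alpha * p; have q0 : 0 < q by rewrite addr_gt0// mulr_gt0.
(* Chosen so that the [p]-th power of [k], times [l ^ n.+1], is the [q]-th power of [diam * l], the
   bound for the denominator on the cube. *)
set k := diam `^ (q / p) * l `^ alpha.
have k0 : 0 < k by rewrite mulr_gt0// powR_gt0// diam_gt0.
have ln0 : 0 < l ^+ n.+1 by rewrite exprn_gt0.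
rewrite -(mulrA 2 _ (l `^ alpha)) -/k.
set J := lint Q0 (fun x => (`|f x - f y| `^ p / edist x y `^ q)%:E).
have JD : J = (Dpa alpha p f y `^ p)%E.
  by rewrite /Dpa -poweRrM mulVf ?gt_eqF// poweRe1//; exact: lint_ge0.
have := Dpa_ge0 alpha p f y; case: (Dpa alpha p f y) JD => [d| |//]; last first.
  move=> _ _; rewrite gt0_muley ?leey// lte_fin mulr_gt0//.
  exact: mulr_gt0.
rewrite poweR_EFin lee_fin => JD d0; apply/lee_addgt0Pr => e e0.
(* The slack makes [s] positive even when [d] is 0; after the factor [2 * l ^ n.+1] it costs exactly
   [e]. *)
pose s := k * d + e / (2 * l ^+ n.+1).
have kds : k * d <= s by rewrite lerDl ltW// divr_gt0// mulr_gt0.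
have s0 : 0 < s.
  by apply: ltr_wpDl; [exact: mulr_ge0 (ltW k0) d0|rewrite divr_gt0// mulr_gt0].
have dl0 : 0 < diam * l by rewrite mulr_gt0// diam_gt0.
(* For [u > s] one has [u <= s ^ (1 - p) * u ^ p]; the second factor pays for inserting the
   denominator. *)
pose c := s `^ (1 - p) * (diam * l) `^ q.
have c0 : 0 < c by rewrite mulr_gt0 ?powR_gt0.
have s1p : s `^ (1 - p) = s / s `^ p.
  by rewrite powRB ?(gt_eqF s0) ?implybT// powRr1 ?ltW.
have split_level x : ocube a l x -> (`|f x - f y|%:E <= s%:E)%E \/
    (`|f x - f y|%:E <= c%:E * (`|f x - f y| `^ p / edist x y `^ q)%:E)%E.
  move=> ax; rewrite -EFinM !lee_fin; have [|sf] := leP (`|f x - f y|) s; first by left.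
  right; have fxy0 : 0 < `|f x - f y| by exact: lt_trans sf.
  have xy : x <> y by move=> e'; move: fxy0; rewrite e' subrr normr0 ltxx.
  have exy0 := edist_gt0 xy.
  apply: (@le_trans _ _ (s `^ (1 - p) * `|f x - f y| `^ p)).
    rewrite s1p mulrAC -mulrA -powR_inv1 ?powR_ge0// -powRrM mulrN1.
    have -> : `|f x - f y| `^ p * s `^ (- p) = (`|f x - f y| / s) `^ p.
      by rewrite powRM ?invr_ge0 ?ltW// -(powR_inv1 (ltW s0)) -powRrM mulN1r.
    rewrite -ler_pdivrMl// mulrC; apply: ge1_le_powR; last exact: ltW.
    by rewrite ler_pdivlMr// mul1r ltW.
  rewrite /c -mulrA; apply: ler_wpM2l; first exact: powR_ge0.
  rewrite mulrCA ler_peMr ?powR_ge0// ler_pdivlMr ?powR_gt0// mul1r.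
  apply: ge0_ler_powR; [exact: ltW|exact: ltW|exact: ltW|].
  exact: edist_ocube ax ay.
apply: le_trans (lint_max (ltW s0) split_level) _.
rewrite lintZ//.
have JQ : (lint (ocube a l) (fun x => (`|f x - f y| `^ p / edist x y `^ q)%:E) <=
    (d `^ p)%:E)%E by rewrite -JD; exact: le_lint.
have lQ := lam_ocube_le a l0.
apply: (@le_trans _ _ (s%:E * (l ^+ n.+1)%:E + c%:E * (d `^ p)%:E)%E).
  by apply: leeD; apply: lee_wpmul2l => //; rewrite lee_fin ltW.
rewrite -!EFinM -EFinD lee_fin.
(* The part above the level costs no more than the part below it, because [k * d <= s]. *)
have cd : c * d `^ p <= s * l ^+ n.+1.
  have -> : c * d `^ p = s / s `^ p * l ^+ n.+1 * (k * d) `^ p.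
    rewrite /c s1p (powRM _ (ltW k0) d0) /k !powRM ?powR_ge0 ?ltW ?diam_gt0//.
    rewrite -!powRrM divfK ?gt_eqF// /q (@powRD _ l) ?(gt_eqF l0) ?implybT//.
    by rewrite powR_mulrn ?ltW//; ring.
  rewrite (_ : _ * _ = s * l ^+ n.+1 * ((k * d) `^ p / s `^ p)); last by ring.
  rewrite ger_pMr ?mulr_gt0// ler_pdivrMr ?powR_gt0// mul1r.
  apply: ge0_ler_powR => //; [exact: ltW|rewrite nnegrE mulr_ge0// ltW//|exact: ltW].
apply: le_trans (lerD (lexx _) cd) _.
rewrite (_ : _ + _ = 2 * k * l ^+ n.+1 * d + e)// /s; field.
by rewrite gt_eqF.
Qed.

Lemma riesz_ocube_ge (alpha : R) F a l z : alpha < n.+1%:R -> 0 < l ->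
  ocube a l `<=` Q0 -> ocube a l z -> (forall x, Q0 x -> (0 <= F x)%E) ->
  (((diam * l) `^ (alpha - n.+1%:R))%:E * lint (ocube a l) F <= riesz alpha F z)%E.
Proof.
move=> an l0 aQ az F0; have dl0 : 0 < diam * l by rewrite mulr_gt0// diam_gt0.
rewrite /riesz -lintZ; last exact: powR_gt0.
(* At [x = z] the kernel is 0 by convention and its lower bound fails, so this null point is
   discarded. *)
apply: (@le_lint_ae _ _ _ _ _ _ [set z] (lam_set1 z) aQ) => x ax xz.
rewrite muleC; apply: lee_wpmul2l; first exact/F0/aQ.
rewrite lee_fin; apply: neg_powR_anti; last by rewrite subr_le0 ltW.
  by apply: edist_gt0 => zx; apply: xz.
exact: edist_ocube az ax.
Qed.

(* In fact [lam Q0 = 1]; keeping it as a normalizing factor makes the scaling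
   identity [lam_ocube] sufficient. If it were 0, all integrals would vanish. *)
Definition osc_cst (alpha p : R) : R :=
  2 * diam `^ ((n.+1%:R + alpha * p) / p) * diam `^ (n.+1%:R - alpha) /
    fine (lam Q0).

Lemma osc_cst_gt0 alpha p : (0 < lam Q0)%E -> 0 < osc_cst alpha p.
Proof.
move=> Q0_gt0; rewrite divr_gt0//.
by rewrite fine_gt0// Q0_gt0 (le_lt_trans lam_Q0_le1)// ltry.
Qed.

Lemma ocube_oscillation (alpha p : R) (f : V -> R) a l :
  0 < alpha < 1 -> 1 < p -> 0 < l -> ocube a l `<=` Q0 -> (0 < lam Q0)%E ->
  (((l ^+ n.+1)^-1)%:E * lint (ocube a l) (fun y =>
      lint (ocube a l) (fun x => `|f x - f y|%:E)) <=
    lint (ocube a l) (fun z =>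
      (osc_cst alpha p)%:E * riesz alpha (Dpa alpha p f) z))%E.
Proof.
move=> /andP[alpha0 alpha1] p1 l0 aQ Q0_gt0.
have := osc_cst_gt0 alpha p Q0_gt0; rewrite /osc_cst.
set k := diam `^ ((n.+1%:R + alpha * p) / p).
set C := _ / _ => C0.
set K := 2 * k * l `^ alpha * l ^+ n.+1.
set I := lint (ocube a l) (Dpa alpha p f).
have k0 : 0 < k by rewrite powR_gt0// diam_gt0.
have ln0 : 0 < l ^+ n.+1 by rewrite exprn_gt0.
have la0 : 0 < l `^ alpha by rewrite powR_gt0.
have K0 : 0 < K by rewrite !mulr_gt0.
have I0 : (0 <= I)%E by exact: lint_ge0.
have an : alpha < n.+1%:R by apply: lt_le_trans alpha1 _; rewrite ler1n.
have lQ0 : lam Q0 = (fine (lam Q0))%:E.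
  by rewrite fineK// ge0_fin_numE ?lam_ge0// (le_lt_trans lam_Q0_le1)// ltry.
set c := fine (lam Q0) in lQ0 C C0 *.
have c0 : 0 < c by move: Q0_gt0; rewrite lQ0 lte_fin.
have dl0 : 0 < diam * l by rewrite mulr_gt0// diam_gt0.
set P := (diam * l) `^ (alpha - n.+1%:R).
have P0 : 0 < P by rewrite powR_gt0.
apply: (@le_trans _ _ (((l ^+ n.+1)^-1)%:E * (K%:E * I))%E).
  apply: lee_wpmul2l; first by rewrite lee_fin invr_ge0 ltW.
  rewrite -lintZ//; apply: le_lint => // y ay; exact: lint_ocube_diff.
apply: (@le_trans _ _ (C%:E * (P%:E * I) * lam (ocube a l))%E); last first.
  apply: le_trans (lint_cst_ge _ _) _.
    by rewrite !mule_ge0// lee_fin ltW.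
  apply: le_lint => // z az; apply: lee_wpmul2l; first by rewrite lee_fin ltW.
  by apply: riesz_ocube_ge => // x _; exact: Dpa_ge0.
(* The two factors of [I] coincide: both are [2 * k] times the [alpha]-th power of [l], the measure
   [c] of [Q0] cancelling against the denominator of [C]. *)
rewrite lam_ocube// lQ0 -EFinM 2!muleA -!EFinM [leRHS]muleAC -EFinM.
apply: lee_wpmul2r => //; rewrite lee_fin le_eqVlt; apply/orP; left; apply/eqP.
have -> : P = (diam `^ (n.+1%:R - alpha))^-1 * (l `^ alpha / l ^+ n.+1).
  rewrite /P powRM ?ltW ?diam_gt0// -powRN opprB.
  by rewrite (@powRB _ l) ?(gt_eqF l0) ?implybT// powR_mulrn ?ltW.
rewrite /K /C; field; rewrite !gt_eqF// powR_gt0// diam_gt0//.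
Qed.

End cubes.

(** * The potential between the two function spaces, and integrability of [f] *)

Section riesz_rinorm.
Context {R : realType} {n : nat}.
Local Notation V := 'rV[R]_n.+1.
Local Notation Q0 := (@Defs.Q0 R n.+1).
Implicit Types (f : V -> R) (g : V -> \bar R) (alpha p : R).

Lemma riesz_scale alpha (c : R) g z : 0 < c ->
  riesz alpha (fun x => (c%:E * g x)%E) z = (c%:E * riesz alpha g z)%E.
Proof.
move=> c0; rewrite -[RHS](lintZ Q0 _ c0); congr (lint Q0 _).
by apply/funext => y; rewrite muleA.
Qed.

Lemma Mplus_scale (c : R) g : 0 < c -> Mplus g -> Mplus (fun x => (c%:E * g x)%E).
Proof.
move=> c0 [mg g0]; split => [t|x Qx]; last first.
  by rewrite mule_ge0 ?g0// lee_fin ltW.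
have := mg (c^-1 * t); congr (lmeas (Q0 `&` _)).
by apply/seteqP; split => x /=; rewrite EFinM lte_pdivrMl.
Qed.

Lemma Mplus_riesz alpha g : alpha < 1 -> Mplus g -> Mplus (riesz alpha g).
Proof.
move=> a1 [mg g0]; split => [|x _]; last exact: riesz_ge0.
by apply: riesz_emeas => //; apply: lt_le_trans a1 _; rewrite ler1n.
Qed.

(** [opnorm] is a supremum over the unit ball, so [g] is divided by its norm. If the norm is 0, then
    [g] vanishes almost everywhere and its potential everywhere. *)
Lemma rho_riesz_le alpha (X Y : rinorm R n.+1) g :
  alpha < 1 -> Mplus g -> (rho Y g < +oo)%E ->
  (rho X (riesz alpha g) <= opnorm alpha X Y * rho Y g)%E.
Proof.
move=> a1 Mg gY; have Mr := Mplus_riesz a1 Mg.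
have : rho Y g = (fine (rho Y g))%:E by rewrite fineK// ge0_fin_numE// rho_ge0.
have := rho_ge0 Y Mg; move: (fine _) => r + rE.
rewrite rE lee_fin le_eqVlt => /predU1P[r0|r0].
  have /(rho_eq0 Y Mg)[N [N0 gN]] : rho Y g = 0%E by rewrite rE -r0.
  have rg0 z : riesz alpha g z = 0%E.
    apply/eqP; rewrite eq_le riesz_ge0 andbT /riesz -[leRHS](@lint0 R n Q0).
    apply: (@le_lint_ae _ _ _ _ _ _ N N0) => // y Qy Ny.
    by rewrite gN// mul0e.
  rewrite -r0 mule0 (_ : rho X _ = 0%E)//; apply/(rho_eq0 X Mr).
  by exists set0; split => //; exact: lam0.
have ri0 : 0 < r^-1 by rewrite invr_gt0.
rewrite muleC -lee_pdivrMl// -rho_scale//; last exact: ltW.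
apply: ereal_sup_ubound; exists (fun x => (r^-1%:E * g x)%E) => /=.
  split; first exact: Mplus_scale.
  rewrite rho_scale//; last exact: ltW.
  by rewrite rE -EFinM mulVf ?gt_eqF.
by congr rho; apply/funext => z; rewrite riesz_scale.
Qed.

Lemma Mplus0 : Mplus (fun _ : V => 0%E : \bar R).
Proof.
split=> //; apply: lsc_emeas => x a a0.
by exists setT => //; exact: filterT.
Qed.

Lemma opnorm_ge0 alpha (X Y : rinorm R n.+1) :
  alpha < 1 -> (0 <= opnorm alpha X Y)%E.
Proof.
move=> a1; apply: le_trans (rho_ge0 X (Mplus_riesz a1 Mplus0)) _.
apply: ereal_sup_ubound; exists (fun=> 0%E) => //; split; first exact: Mplus0.
rewrite (_ : rho Y _ = 0%E)//; apply/(rho_eq0 Y Mplus0).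
by exists set0; split => //; exact: lam0.
Qed.

Lemma Mplus_Dpa alpha p f : 0 < alpha -> 0 < p ->
  emeas (fun x => (f x)%:E) -> Mplus (Dpa alpha p f).
Proof.
by move=> a0 p0 mf; split => [|x _]; [exact: Dpa_emeas|exact: Dpa_ge0].
Qed.

(** By [rho_local] the function [Dpa] is integrable on [Q0], hence finite at some [y] unless [Q0] is
    null. At that [y] the cube estimate on [Q0], the cube of side 1 at the origin, bounds the
    integral of [|f x - f y|]. *)
Lemma in_W_integrable alpha p (Y : rinorm R n.+1) f :
  0 < alpha -> 1 < p -> in_W Y alpha p f -> Defs.integrable f.
Proof.
move=> alpha0 p1 [mf fY]; split => //; have p0 : 0 < p by exact: lt_trans p1.
have MD := Mplus_Dpa alpha0 p0 mf.
have DQ : (lint Q0 (Dpa alpha p f) < +oo)%E.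
  have [C [C0 /(_ _ MD)]] := rho_local Y lmeas_Q0 (@subset_refl _ Q0).
  by move=> /le_lt_trans; apply; rewrite lte_mul_pinfty// lee_fin ltW.
have [lQ|lQ] := eqVneq (lam Q0) 0%E.
  apply: (@le_lt_trans _ _ (lint Q0 (fun=> 0%E))); last by rewrite lint0 ltry.
  exact: (@le_lint_ae _ _ _ _ _ _ Q0 lQ).
have [y [Qy Dy]] : exists y, Q0 y /\ (Dpa alpha p f y < +oo)%E.
  apply: contrapT => /forallNP Dy; move: DQ; apply/negP; rewrite -leNgt.
  apply: (@le_trans _ _ (lint Q0 (fun=> +oo%E))).
    apply: le_trans (lint_cst_ge _ _) => //.
    by rewrite gt0_mulye// lt0e lQ lam_ge0.
  apply: le_lint => // y Qy; rewrite leNgt; apply/negP => yD.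
  by apply: (Dy y).
have lQ1 : (lam Q0 < +oo)%E by rewrite (le_lt_trans lam_Q0_le1)// ltry.
(* [|f x|] is at most twice the larger of [|f y|] and [|f x - f y|], the form that [lint_max]
   accepts. *)
apply: (@le_lt_trans _ _ ((2 * `|f y|)%:E * lam Q0 +
    lint Q0 (fun x => 2%:E * `|f x - f y|%:E))%E).
  apply: lint_max => [|x _]; first by rewrite mulr_ge0.
  rewrite -EFinM !lee_fin; have := ler_normD (f x - f y) (f y); rewrite subrK => h.
  by have [fxy|/ltW fxy] := leP `|f x - f y| `|f y|; [left|right]; lra.
rewrite lintZ// lte_add_pinfty//.
  by apply: lte_mul_pinfty => //; rewrite lee_fin mulr_ge0.
apply: lte_mul_pinfty => //.
have Q0E : Q0 = ocube 0 1.
  by apply/seteqP; split => x + i => /(_ i); rewrite /Defs.coord !mxE add0r.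
have := @lint_ocube_diff R n alpha p f 0 1 y alpha0 p1 ltr01.
rewrite -Q0E => /(_ (@subset_refl _ _) Qy)/le_lt_trans; apply.
by apply: lte_mul_pinfty => //; rewrite lee_fin !mulr_ge0// powR_ge0.
Qed.

End riesz_rinorm.

(** * Choice of the constant and summation over the cubes *)

Unset Implicit Arguments.

Theorem theorem4p3 (R : realType) (n : nat) (alpha p : R) :
  0 < alpha < 1 -> 1 < p < n%:R / alpha ->
  exists C : R, 0 < C /\
    forall X Y : rinorm R n, (opnorm alpha X Y < +oo)%E ->
    forall f : 'rV[R]_n -> R, in_W Y alpha p f ->
      GaRo X f /\
      Gamma X f (fun z => (C%:E * riesz alpha (Dpa alpha p f) z)%E) /\
      (garo_norm X f <= C%:E * opnorm alpha X Y * W_norm Y alpha p f)%E.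
Proof.
move=> alpha01 /andP[p1 pn]; have /andP[alpha0 alpha1] := alpha01.
(* In dimension 0 the condition on [p] would read [p < 0]. *)
case: n pn => [|n] pn; first by move: pn; rewrite mul0r; lra.
have p0 : 0 < p by exact: lt_trans p1.
(* [osc_cst] divides by [lam Q0]; if that were 0, the oscillations would vanish and any positive
   constant would do. *)
pose C := if lam (@Q0 R n.+1) == 0%E then 1 else @osc_cst R n alpha p.
have C0 : 0 < C.
  rewrite /C; case: ifPn => // lQ; apply: osc_cst_gt0.
  by rewrite lt0e lQ lam_ge0.
exists C; split => // X Y XY f fW.
have [mf fY] := fW; have MD := Mplus_Dpa alpha0 p0 mf.
have MR := Mplus_riesz alpha1 MD.
have rX : (rho X (fun z => C%:E * riesz alpha (Dpa alpha p f) z) <=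
    C%:E * opnorm alpha X Y * W_norm Y alpha p f)%E.
  rewrite rho_scale//; last exact: ltW.
  rewrite -muleA; apply: lee_wpmul2l; first by rewrite lee_fin ltW.
  exact: rho_riesz_le.
have opX := opnorm_ge0 X Y alpha1.
have GX : Gamma X f (fun z => (C%:E * riesz alpha (Dpa alpha p f) z)%E).
  split; first exact: Mplus_scale.
  split.
    apply: le_lt_trans rX _.
    apply: lte_mul_pinfty => //; first by rewrite mule_ge0// lee_fin ltW.
    by rewrite fin_numM// ge0_fin_numE.
  (* The inequality holds cube by cube and is then summed. *)
  move=> I a l [Ql _]; apply: lee_nneseries => [i _|i].
    rewrite in_setE => /Ql[li0 _].
    by rewrite mule_ge0 ?lint_ge0// lee_fin invr_ge0 exprn_ge0// ltW.
  rewrite in_setE => Ii; have [li0 aQ] := Ql _ Ii.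
  rewrite /C; case: ifPn => [/eqP lQ|lQ]; last first.
    by apply: ocube_oscillation => //; rewrite lt0e lQ lam_ge0.
  apply: (@le_trans _ _ 0%E); last exact: lint_ge0.
  rewrite (_ : lint _ _ = 0%E) ?mule0//; apply/eqP; rewrite eq_le lint_ge0 andbT.
  rewrite -[leRHS](@lint0 R n (ocube (a i) (l i))).
  by apply: (@le_lint_ae _ _ _ _ _ _ _ lQ) => // y /aQ.
split; first by split; [exact: in_W_integrable fW|eexists; exact: GX].
split => //; apply: le_trans rX; apply: ereal_inf_lbound.
by eexists; first exact: GX.
Qed.
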